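(* Let $n-s\geq s$ and let $\Gamma\subset\mathrm{Iso}(\mathbb{R}^n_s)$ be a subgroup whose centralizer $\mathrm{Z}_{\mathrm{Iso}(\mathbb{R}^n_s)}(\Gamma)$ in $\mathrm{Iso}(\mathbb{R}^n_s)$ acts transitively on $\mathbb{R}^n_s$. If $\mathrm{Hol}(\Gamma)$ is non-abelian, then $s\geq 7$ and $n\geq 14$. This lower bound is sharp: there exists a subgroup $\Gamma\subset\mathrm{Iso}(\mathbb{R}^{14}_7)$ with transitive centralizer in $\mathrm{Iso}(\mathbb{R}^{14}_7)$ and with $\mathrm{Hol}(\Gamma)$ non-abelian.
   Context: $\mathbb{R}^n_s$ denotes $\mathbb{R}^n$ with a non-degenerate symmetric bilinear form of signature $(n-s,s)$, and $\mathrm{Iso}(\mathbb{R}^n_s)$ is its group of (affine) isometries. Throughout, $n-s\geq s$. Affine maps are written $\gamma=(I+A,v)$, with linear part $I+A$ and translation part $v$. The linear holonomy group of $\Gamma$ is $\mathrm{Hol}(\Gamma)=\{I+A \mid (I+A,v)\in\Gamma\}$. *)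

(* Defs.v *)
From HB Require Import structures.
From mathcomp Require Import all_boot all_order all_algebra.
From mathcomp Require Import classical_sets reals.

Set Implicit Arguments.
Unset Strict Implicit.
Unset Printing Implicit Defensive.

Import GRing.Theory.
Local Open Scope ring_scope.

(* The columns of P form a basis whose Gram matrix is diag(1^p, (-1)^q). By
   Sylvester's law of inertia (p, q) is then determined by B; in particular B
   is nondegenerate. *)
Definition has_signature (R : realType) (n : nat) (B : {symmetric 'cV[R]_n})
    (p q : nat) : Prop :=
  (p + q)%N = n /\
  exists2 P : 'M[R]_n, P \in unitmx &
    forall i j : 'I_n,
      B (col i P) (col j P) = if i == j then (if (i < p)%N then 1 else -1) else 0.

(* The affine group of R^n: the pair (M, v) stands for x |-> M *m x + v. *)
Definition affine (R : realType) (n : nat) : Type :=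
  {g : 'M[R]_n * 'cV[R]_n | g.1 \in unitmx}.

HB.instance Definition _ (R : realType) (n : nat) := Choice.on (affine R n).

Definition linpart (R : realType) (n : nat) (g : affine R n) : 'M[R]_n :=
  (val g).1.

Definition transpart (R : realType) (n : nat) (g : affine R n) : 'cV[R]_n :=
  (val g).2.

Definition affine_act (R : realType) (n : nat) (g : affine R n) (x : 'cV[R]_n) :
    'cV[R]_n :=
  linpart g *m x + transpart g.

Lemma linpart_unit (R : realType) (n : nat) (g : affine R n) :
  linpart g \in unitmx.
Proof. exact: (valP g). Qed.

Lemma affine_mul_subproof (R : realType) (n : nat) (g h : affine R n) :
  linpart g *m linpart h \in unitmx.
Proof. by rewrite unitmx_mul !linpart_unit. Qed.

Lemma affine_inv_subproof (R : realType) (n : nat) (g : affine R n) :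
  invmx (linpart g) \in unitmx.
Proof. by rewrite unitmx_inv linpart_unit. Qed.

Definition affine_one (R : realType) (n : nat) : affine R n :=
  exist _ (1%:M, 0) (unitmx1 R n).

Definition affine_mul (R : realType) (n : nat) (g h : affine R n) : affine R n :=
  exist _ (linpart g *m linpart h, linpart g *m transpart h + transpart g)
        (affine_mul_subproof g h).

Definition affine_inv (R : realType) (n : nat) (g : affine R n) : affine R n :=
  exist _ (invmx (linpart g), - (invmx (linpart g) *m transpart g))
        (affine_inv_subproof g).

Lemma affine_mulgA (R : realType) (n : nat) : associative (@affine_mul R n).
Proof.
move=> f g h; apply: val_inj => /=.
by rewrite /linpart /transpart /= !mulmxA mulmxDr mulmxA addrA.
Qed.

Lemma affine_mul1g (R : realType) (n : nat) :
  left_id (affine_one R n) (@affine_mul R n).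
Proof.
move=> g; apply: val_inj => /=.
by rewrite /linpart /transpart /= !mul1mx addr0; case: (val g).
Qed.

Lemma affine_mulg1 (R : realType) (n : nat) :
  right_id (affine_one R n) (@affine_mul R n).
Proof.
move=> g; apply: val_inj => /=.
by rewrite /linpart /transpart /= mulmx1 mulmx0 add0r; case: (val g).
Qed.

Lemma affine_mulVg (R : realType) (n : nat) :
  left_inverse (affine_one R n) (@affine_inv R n) (@affine_mul R n).
Proof.
move=> g; apply: val_inj => /=.
by rewrite {1}/linpart {2}/transpart /= mulVmx ?linpart_unit // subrr.
Qed.

Lemma affine_mulgV (R : realType) (n : nat) :
  right_inverse (affine_one R n) (@affine_inv R n) (@affine_mul R n).
Proof.
move=> g; apply: val_inj => /=.
rewrite {2}/linpart {1}/transpart /= mulmxV ?linpart_unit //.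
by rewrite mulmxN mulmxA mulmxV ?linpart_unit // mul1mx addNr.
Qed.

HB.instance Definition _ (R : realType) (n : nat) :=
  isGroup.Build (affine R n) (@affine_mulgA R n) (@affine_mul1g R n)
    (@affine_mulg1 R n) (@affine_mulVg R n) (@affine_mulgV R n).

Lemma affine_actM (R : realType) (n : nat) (g h : affine R n) (x : 'cV[R]_n) :
  affine_act (g * h)%g x = affine_act g (affine_act h x).
Proof. by rewrite /affine_act /linpart /transpart /= mulmxDr mulmxA addrA. Qed.

Local Open Scope classical_set_scope.

Definition Iso (R : realType) (n : nat) (B : {symmetric 'cV[R]_n}) :
    set (affine R n) :=
  [set g | isometry B B (mulmx (linpart g))].

Lemma Iso_group_closed (R : realType) (n : nat) (B : {symmetric 'cV[R]_n}) :
  group_closed (mem (Iso B)).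
Proof.
split=> [|g h /set_mem Bg /set_mem Bh]; apply/mem_set => u v /=.
  by rewrite !mul1mx.
have E w : linpart (g / h)%g *m w = linpart g *m (invmx (linpart h) *m w).
  by rewrite mulmxA.
by rewrite !E Bg -Bh !mulmxA !mulmxV ?linpart_unit // !mul1mx.
Qed.

Definition is_subgroup (R : realType) (n : nat) (G H : set (affine R n)) : Prop :=
  G `<=` H /\ group_closed (mem G).

Definition centralizer (R : realType) (n : nat) (H G : set (affine R n)) :
    set (affine R n) :=
  [set z | H z /\ forall g, G g -> commute z g].

Definition acts_transitively (R : realType) (n : nat) (G : set (affine R n)) :
    Prop :=
  forall x y : 'cV[R]_n, exists2 g, G g & affine_act g x = y.

Definition Hol (R : realType) (n : nat) (G : set (affine R n)) : set 'M[R]_n :=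
  (@linpart R n) @` G.

Definition abelian_mx (R : realType) (n : nat) (H : set 'M[R]_n) : Prop :=
  forall M N, H M -> H N -> comm_mx M N.

(* Main.v *)
Require Import Defs.
From mathcomp Require Import all_boot all_order all_algebra.
From mathcomp Require Import boolp classical_sets reals.
From mathcomp Require Import ring lra.

(** Transitivity at the origin gives, for every vector [c], an isometry [C]
    commuting with all linear parts [I + A] of [Gamma] such that
    [C v = v + A c] for every [(I + A, v)] in [Gamma].  Since [C] preserves the
    products of translation parts, polarization in [c] shows that the [A]'s are
    skew, anticommute and have square zero, and that [A1 v2 = - A2 v1].

    Let [A1 A2 <> 0] and [v3 = A1 v2].  As [C v3 = v3 + A1 A2 c] with [C]
    invertible, [v3] is not in the image of [A1 A2].  If [<A1 A2 x, y> <> 0], then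
    the vectors obtained from [x, y] by applying [1, A1, A2, A1 A2] span an
    8-dimensional space not containing [v3], so some [z] orthogonal to it has
    [<v3, z> <> 0].  The vectors
    [A1 x, A1 y, A1 A2 x, A1 A2 y, A1 z, A2 z, v3] are then linearly independent
    and span a totally isotropic space, hence [s >= 7].

    For sharpness, these seven vectors together with a dual family are taken as
    a basis of R^14; [Gamma] is the double centralizer of the two resulting
    affine isometries. *)

Set Implicit Arguments.
Unset Strict Implicit.
Unset Printing Implicit Defensive.

Import Order.TTheory GRing.Theory Num.Theory.
Local Open Scope ring_scope.

(** * Symmetric bilinear forms of given signature *)

Section SymmetricForm.
Variables (R : realType) (n : nat) (B : {symmetric 'cV[R]_n}).

Lemma sformC u v : B u v = B v u.
Proof. by rewrite hermC expr0 mul1r. Qed.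

Lemma sformDl u v w : B (u + v) w = B u w + B v w.
Proof. exact: linearDl. Qed.

Lemma sformZl a u w : B (a *: u) w = a * B u w.
Proof. exact: linearZl_LR. Qed.

Lemma sformNl u w : B (- u) w = - B u w.
Proof. exact: linearNl. Qed.

Lemma sform0l w : B 0 w = 0.
Proof. exact: linear0l. Qed.

Lemma sformDr u v w : B w (u + v) = B w u + B w v.
Proof. exact: linearDr. Qed.

Lemma sformZr a u w : B w (a *: u) = a * B w u.
Proof. by rewrite sformC sformZl sformC. Qed.

Lemma sformNr u w : B w (- u) = - B w u.
Proof. exact: linearNr. Qed.

Lemma sform0r w : B w 0 = 0.
Proof. exact: linear0r. Qed.

Lemma sform_suml (I : finType) (F : I -> 'cV[R]_n) w :
  B (\sum_i F i) w = \sum_i B (F i) w.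
Proof. exact: linear_sumlz. Qed.

Lemma sform_sumr (I : finType) (F : I -> 'cV[R]_n) w :
  B w (\sum_i F i) = \sum_i B w (F i).
Proof. exact: linear_sumr. Qed.

Lemma mulmx_col_sum m (P : 'M[R]_(n, m)) (a : 'cV[R]_m) :
  P *m a = \sum_i a i 0 *: col i P.
Proof.
apply/colP => i; rewrite mxE summxE; apply: eq_bigr => j _.
by rewrite !mxE mulrC.
Qed.

Lemma sform_diag (p : nat) (P : 'M[R]_n) (a b : 'cV[R]_n) :
    (forall i j : 'I_n,
      B (col i P) (col j P) = if i == j then (if (i < p)%N then 1 else -1) else 0) ->
  B (P *m a) (P *m b) =
    \sum_(i < n) (if (i < p)%N then 1 else -1) * (a i 0 * b i 0).
Proof.
move=> BP; rewrite !mulmx_col_sum sform_suml; apply: eq_bigr => i _.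
rewrite sformZl sform_sumr (bigD1 i) //= big1 => [|j ji]; last first.
  by rewrite sformZr BP eq_sym (negbTE ji) mulr0.
by rewrite sformZr BP eqxx; case: ifP => _; ring.
Qed.

Variables (p q : nat).
Hypothesis Bpq : has_signature B p q.

Lemma sform_nondegenerate u : (forall w, B u w = 0) -> u = 0.
Proof.
case: Bpq => _ [P uP BP] Bu0.
suff a0 : invmx P *m u = 0 by rewrite -[u](mulKVmx uP) a0 mulmx0.
apply/colP => i; rewrite [RHS]mxE.
have := Bu0 (P *m delta_mx i 0).
rewrite -{1}[u](mulKVmx uP) (sform_diag _ _ BP) (bigD1 i) //= big1 => [|j ji].
  rewrite [delta_mx _ _ _ _]mxE !eqxx mulr1 addr0 => /eqP.
  by rewrite mulf_eq0; case: ifP; rewrite ?oppr_eq0 oner_eq0 /= => _ /eqP.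
by rewrite [delta_mx _ _ _ _]mxE (negbTE ji) /= !mulr0.
Qed.

Lemma sform_inj u v : (forall w, B u w = B v w) -> u = v.
Proof.
move=> uv; apply/eqP; rewrite -subr_eq0; apply/eqP/sform_nondegenerate => w.
by rewrite sformDl sformNl uv subrr.
Qed.

(* Otherwise some nonzero combination of the family has its last [q]
   coordinates zero, and the form is positive definite on such vectors. *)
Lemma isotropic_family_size k (w : 'I_k -> 'cV[R]_n) :
    (forall i j, B (w i) (w j) = 0) ->
    (forall c : 'I_k -> R, \sum_i c i *: w i = 0 -> forall i, c i = 0) ->
  (k <= q)%N.
Proof.
case: Bpq => pq [P uP BP] w0 wfree; rewrite leqNgt; apply/negP => qk.
have lt_pq (j : 'I_q) : (p + j < n)%N by rewrite -pq ltn_add2l.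
(* The rows of [D] hold the last [q] coordinates of the family; with more rows than columns, [D] has
   a nonzero left kernel. *)
pose D : 'M[R]_(k, q) :=
  \matrix_(i, j) (invmx P *m w i) (Ordinal (lt_pq j)) 0.
have /rowV0Pn[c /sub_kermxP cD c0] : kermx D != 0.
  rewrite -mxrank_eq0 mxrank_ker subn_eq0 -ltnNge.
  exact: leq_ltn_trans (rank_leq_col _) qk.
pose u := \sum_i c 0 i *: w i.
have Bu : B u u = 0.
  rewrite sform_suml big1 // => i _; rewrite sformZl sform_sumr big1 ?mulr0 // => j _.
  by rewrite sformZr w0 mulr0.
have lastu (j : 'I_n) : (p <= j)%N -> (invmx P *m u) j 0 = 0.
  move=> pj; have jq : (j - p < q)%N by rewrite ltn_subLR // pq.
  move/matrixP: cD => /(_ 0 (Ordinal jq)) cD; rewrite [LHS]mxE [RHS]mxE in cD.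
  rewrite /u mulmx_sumr summxE -[RHS]cD; apply: eq_bigr => i _.
  rewrite -scalemxAr !mxE; congr (_ * _); apply: eq_bigr => l _.
  by congr (invmx P _ _ * _); apply/val_inj; rewrite /= subnKC.
have /eqP := Bu; rewrite -[u](mulKVmx uP) (sform_diag _ _ BP).
rewrite psumr_eq0 => [|i _]; last first.
  case: ifP => [_|/negbT]; first by rewrite mul1r -expr2 sqr_ge0.
  by rewrite -leqNgt => /lastu ->; rewrite !mulr0.
move=> /allP a0; case/negP: c0; apply/eqP/rowP => i; rewrite [RHS]mxE.
apply: (wfree (fun i => c 0 i)); rewrite -/u -[u](mulKVmx uP).
rewrite [invmx P *m u](_ : _ = 0) ?mulmx0 //; apply/colP => j; rewrite [RHS]mxE.
have [jp|/lastu //] := ltnP j p.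
have := a0 j (mem_index_enum _); rewrite jp mul1r mulf_eq0 orbb.
by move/eqP.
Qed.

(** A subspace is its own double orthogonal: [G], the Gram matrix of the standard basis, is
    invertible, so orthogonality to the family can be tested on the columns of [cokermx F] pulled
    back by [invmx G]. *)
Lemma mem_span_of_orthogonal k (f : 'I_k -> 'cV[R]_n) v :
    (forall z, (forall i, B (f i) z = 0) -> B v z = 0) ->
  exists c : 'I_k -> R, v = \sum_i c i *: f i.
Proof.
move=> fv.
pose G : 'M[R]_n := \matrix_(i, j) B (delta_mx i 0) (delta_mx j 0).
have BG u w : B u w = (u^T *m G *m w) 0 0.
  have sum_delta (t : 'cV[R]_n) : t = \sum_i t i 0 *: delta_mx i 0.
    by rewrite {1}(matrix_sum_delta t); apply: eq_bigr => i _; rewrite big_ord1.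
  rewrite [in LHS](sum_delta u) [in LHS](sum_delta w) sform_sumr mxE.
  apply: eq_bigr => j _; rewrite sformZr sform_suml mxE mulrC; congr (_ * _).
  by apply: eq_bigr => i _; rewrite sformZl !mxE.
have uG : G \in unitmx.
  rewrite -row_free_unit -kermx_eq0; apply/rowV0P => u /sub_kermxP uG.
  apply: trmx_inj; rewrite trmx0; apply: sform_nondegenerate => w.
  by rewrite BG trmxK uG mul0mx mxE.
pose F : 'M[R]_(k, n) := \matrix_(i, j) f i j 0.
have : (v^T <= F)%MS.
  rewrite submxE; apply/eqP/rowP => j; rewrite [RHS]mxE.
  have := fv (invmx G *m col j (cokermx F)).
  rewrite BG mulmxA mulmxK // => <-; first by rewrite !mxE; apply: eq_bigr => i _; rewrite !mxE.
  move=> i; rewrite BG mulmxA mulmxK //.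
  have /matrixP/(_ i j) := mulmx_coker F; rewrite !mxE => {2}<-.
  by apply: eq_bigr => l _; rewrite !mxE.
case/submxP => c vF; exists (fun i => c 0 i); apply: trmx_inj.
rewrite vF; apply/rowP => j; rewrite !mxE summxE; apply: eq_bigr => i _.
by rewrite !mxE.
Qed.

End SymmetricForm.

(** * Seven independent vectors in a totally isotropic space *)

Section IsotropicSeven.
Variables (R : realType) (n : nat) (B : {symmetric 'cV[R]_n}) (p q : nat).
Hypothesis Bpq : has_signature B p q.

Variables (a b : 'M[R]_n) (v1 v2 : 'cV[R]_n).
Hypotheses (skew_a : forall u w, B (a *m u) w = - B u (a *m w))
           (skew_b : forall u w, B (b *m u) w = - B u (b *m w)).
Hypotheses (aa0 : forall u : 'cV[R]_n, a *m (a *m u) = 0)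
           (bb0 : forall u : 'cV[R]_n, b *m (b *m u) = 0)
           (anti_ab : forall u : 'cV[R]_n, b *m (a *m u) = - (a *m (b *m u))).
Hypotheses (bv2 : b *m v2 = 0)
           (anti_v : a *m v2 = - (b *m v1)).
Hypotheses (ab_neq0 : a *m b != 0)
           (v3_nim : forall u : 'cV[R]_n, a *m v2 <> a *m (b *m u)).

Let Baa u w : B (a *m u) (a *m w) = 0.
Proof. by rewrite skew_a aa0 sform0r oppr0. Qed.

Let Bbb u w : B (b *m u) (b *m w) = 0.
Proof. by rewrite skew_b bb0 sform0r oppr0. Qed.

(** The product of two anticommuting skew maps is skew, so this form is alternating. *)
Let om u w := B (a *m (b *m u)) w.

Let om_skew u w : om u w = - om w u.
Proof. by rewrite /om skew_a skew_b opprK anti_ab sformNr (sformC B u). Qed.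

Let om_alt u : om u u = 0.
Proof. by have := om_skew u u; lra. Qed.

Let Bab u w : B (a *m u) (b *m w) = om u w.
Proof. by rewrite om_skew /om (sformC B _ u) skew_a. Qed.

Let Bba u w : B (b *m u) (a *m w) = - om u w.
Proof. by rewrite sformC Bab om_skew. Qed.

Let om_bl u w : om (b *m u) w = 0.
Proof. by rewrite /om bb0 mulmx0 sform0l. Qed.

Let om_br u w : om u (b *m w) = 0.
Proof. by rewrite om_skew om_bl oppr0. Qed.

Let v3 := a *m v2.

Let Bv3a u : B v3 (a *m u) = 0.
Proof. exact: Baa. Qed.

Let Bv3b u : B v3 (b *m u) = 0.
Proof. by rewrite /v3 anti_v sformNl Bbb oppr0. Qed.

Lemma exists_om_neq0 : exists x y, om x y != 0.
Proof.
apply: contrapT => none; case/eqP: ab_neq0; apply/matrixP => i j.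
have ab0 (x : 'cV[R]_n) : a *m (b *m x) = 0.
  apply: (sform_nondegenerate Bpq) => y; apply: contrapT => /eqP xy.
  by apply: none; exists x, y.
rewrite [RHS]mxE; have /colP/(_ i) := ab0 (delta_mx j 0).
by rewrite mulmxA -colE !mxE.
Qed.

Variables (x y : 'cV[R]_n).
Hypothesis om_xy : om x y != 0.

Let F : seq 'cV[R]_n :=
  [:: x; a *m x; b *m x; a *m (b *m x); y; a *m y; b *m y; a *m (b *m y)].

Let eq0_om r : r * om x y = 0 -> r = 0.
Proof. by move/eqP; rewrite mulf_eq0 (negbTE om_xy) orbF => /eqP. Qed.

(** Otherwise [v3] lies in the span of [F]. As [v3] is orthogonal to the images of [a] and [b],
    pairing with six vectors of [F] kills every coefficient except those of [a *m (b *m x)] and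
    [a *m (b *m y)], which puts [v3] in the image of [a *m b]. *)
Lemma exists_orthogonal_vector :
  exists2 z, (forall u, u \in F -> B u z = 0) & B v3 z != 0.
Proof.
apply: contrapT => none.
have [|c v3E] := @mem_span_of_orthogonal _ _ _ _ _ Bpq 8 (fun i => F`_i) v3.
  move=> z Fz; apply: contrapT => /eqP v3z; apply: none; exists z => // u uF.
  rewrite -(nth_index 0 uF).
  by have uF8 : (index u F < 8)%N := etrans (index_mem _ _) uF; exact: (Fz (Ordinal uF8)).
move: v3E; rewrite !big_ord_recl big_ord0 addr0 /=.
move: (c _) (c _) (c _) (c _) (c _) (c _) (c _) (c _).
move=> c7 c6 c5 c4 c3 c2 c1 c0 v3E.
have pair t : B v3 t = c0 * B x t + (c1 * B (a *m x) t + (c2 * B (b *m x) t +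
    (c3 * B (a *m (b *m x)) t + (c4 * B y t + (c5 * B (a *m y) t +
    (c6 * B (b *m y) t + c7 * B (a *m (b *m y)) t)))))).
  by rewrite v3E !sformDl !sformZl.
have Babr u w : B u (a *m (b *m w)) = - om u w by rewrite sformC -/(om w u) om_skew.
(* In this order, each test vector pairs nontrivially with only one of the terms not yet
   eliminated. *)
have c00 : c0 = 0.
  have := pair (a *m (b *m y)); rewrite Bv3a !Baa !Bba !Babr om_alt !om_br.
  by rewrite !mulr0 !oppr0 !mulr0 !addr0 mulrN => /esym/eqP; rewrite oppr_eq0 => /eqP/eq0_om.
have c40 : c4 = 0.
  have := pair (a *m (b *m x)); rewrite Bv3a !Baa !Bba !Babr om_alt !om_br.
  rewrite !mulr0 !oppr0 !mulr0 !add0r !addr0 om_skew opprK.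
  by move/esym/eq0_om.
have c20 : c2 = 0.
  have := pair (a *m y); rewrite Bv3a !Baa !Bba c00 c40 om_alt.
  rewrite !mul0r oppr0 !mulr0 !add0r !addr0 mulrN => /esym/eqP.
  by rewrite oppr_eq0 => /eqP/eq0_om.
have c60 : c6 = 0.
  have := pair (a *m x); rewrite Bv3a !Baa !Bba c00 c40 om_alt.
  by rewrite !mul0r oppr0 !mulr0 !add0r !addr0 om_skew opprK => /esym/eq0_om.
have c10 : c1 = 0.
  have := pair (b *m y); rewrite Bv3b !Bab !Bbb c00 c40 !om_bl om_alt.
  by rewrite !mul0r !mulr0 !add0r !addr0 => /esym/eq0_om.
have c50 : c5 = 0.
  have := pair (b *m x); rewrite Bv3b !Bab !Bbb c00 c40 !om_bl om_alt.
  rewrite !mul0r !mulr0 !add0r !addr0 om_skew mulrN => /esym/eqP.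
  by rewrite oppr_eq0 => /eqP/eq0_om.
apply: (@v3_nim (c3 *: x + c7 *: y)); rewrite -/v3 v3E.
rewrite c00 c10 c20 c40 c50 c60 !scale0r !add0r.
by rewrite !mulmxDr -!scalemxAr.
Qed.

Variable z : 'cV[R]_n.
Hypotheses (Fz : forall u, u \in F -> B u z = 0) (v3z : B v3 z != 0).

Let w : seq 'cV[R]_n :=
  [:: a *m x; a *m y; a *m (b *m x); a *m (b *m y); a *m z; v3; b *m z].

(** All vectors but [b *m z] lie in the image of [a], which is isotropic because [a] is skew with
    square zero. For [b *m z] the products reduce to [om], and vanish because [b] squares to zero or
    because [z] is orthogonal to [F]; the product with [v3] vanishes since [v3 = - (b *m v1)]. *)
Lemma isotropic_family s t : s \in w -> t \in w -> B s t = 0.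
Proof.
have Fzr u : u \in F -> B z u = 0 by move=> uF; rewrite sformC Fz.
have bz r : r \in w -> B (b *m z) r = 0.
  rewrite !inE => /or4P[/eqP->|/eqP->|/eqP->|/or4P[/eqP->|/eqP->|/eqP->|/eqP->]]; last 1 first.
  - exact: Bbb.
  - by rewrite Bba om_skew /om Fz ?oppr0 // !inE eqxx !orbT.
  - by rewrite Bba om_skew /om Fz ?oppr0 // !inE eqxx !orbT.
  - by rewrite Bba om_br oppr0.
  - by rewrite Bba om_br oppr0.
  - by rewrite Bba om_alt oppr0.
  - by rewrite sformC Bv3b.
have im_a r : r \in w -> r = b *m z \/ exists u, r = a *m u.
  rewrite !inE => /or4P[/eqP->|/eqP->|/eqP->|/or4P[/eqP->|/eqP->|/eqP->|/eqP->]];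
    by [left | right; eexists; reflexivity].
move=> /[dup] sw /im_a[->|[u sE]]; first exact: bz.
move=> /[dup] tw /im_a[tE|[r ->]]; first by rewrite sformC tE bz.
by rewrite sE Baa.
Qed.

(** Pairing with [z], [b *m y], [b *m x], [y], [x], [v2], [v1], in this order, isolates one
    coefficient at a time. *)
Lemma free_family (c : 'I_7 -> R) : \sum_i c i *: w`_i = 0 -> forall i, c i = 0.
Proof.
rewrite !big_ord_recl big_ord0 addr0 /=.
suff free c0 c1 c2 c3 c4 c5 c6 :
    c0 *: (a *m x) + (c1 *: (a *m y) + (c2 *: (a *m (b *m x)) +
      (c3 *: (a *m (b *m y)) + (c4 *: (a *m z) + (c5 *: v3 + c6 *: (b *m z))))))
      = 0 ->
    [/\ c0 = 0, c1 = 0, c2 = 0 & [/\ c3 = 0, c4 = 0, c5 = 0 & c6 = 0]].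
  move=> /free[e0 e1 e2 [e3 e4 e5 e6]] [[|[|[|[|[|[|[|//]]]]]]] lt].
  - by rewrite -[RHS]e0; congr c; apply: val_inj.
  - by rewrite -[RHS]e1; congr c; apply: val_inj.
  - by rewrite -[RHS]e2; congr c; apply: val_inj.
  - by rewrite -[RHS]e3; congr c; apply: val_inj.
  - by rewrite -[RHS]e4; congr c; apply: val_inj.
  - by rewrite -[RHS]e5; congr c; apply: val_inj.
  - by rewrite -[RHS]e6; congr c; apply: val_inj.
move=> sum0.
have pair t : c0 * B (a *m x) t + (c1 * B (a *m y) t +
    (c2 * B (a *m (b *m x)) t + (c3 * B (a *m (b *m y)) t +
    (c4 * B (a *m z) t + (c5 * B v3 t + c6 * B (b *m z) t))))) = 0.
  by rewrite -!sformZl -!sformDl sum0 sform0l.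
have az_z : B (a *m z) z = 0 by have := skew_a z z; rewrite (sformC B z); lra.
have bz_z : B (b *m z) z = 0 by have := skew_b z z; rewrite (sformC B z); lra.
have om_z u : u \in [:: x; y] -> om z u = 0.
  rewrite om_skew /om !inE => /orP[]/eqP ->; rewrite Fz ?oppr0 // !inE eqxx ?orbT //.
have c50 : c5 = 0.
  have := pair z; rewrite az_z bz_z.
  rewrite (Fz (u := a *m x)) ?(Fz (u := a *m y)) ?(Fz (u := a *m (b *m x)))
    ?(Fz (u := a *m (b *m y))) ?inE ?eqxx ?orbT // !mulr0 !add0r addr0.
  by move/eqP; rewrite mulf_eq0 (negbTE v3z) orbF => /eqP.
have c00 : c0 = 0.
  have := pair (b *m y); rewrite !Bab Bbb om_alt !om_bl om_z ?inE ?eqxx ?orbT //.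
  by rewrite c50 mul0r !mulr0 !addr0 => /eq0_om.
have c10 : c1 = 0.
  have := pair (b *m x); rewrite !Bab Bbb om_alt !om_bl om_z ?inE ?eqxx ?orbT //.
  rewrite c50 c00 !mul0r !mulr0 !addr0 add0r om_skew mulrN => /eqP.
  by rewrite oppr_eq0 => /eqP/eq0_om.
have az0 u : a *m u \in F -> B (a *m z) u = 0.
  by move=> uF; rewrite skew_a sformC Fz ?oppr0.
have bz0 u : b *m u \in F -> B (b *m z) u = 0.
  by move=> uF; rewrite skew_b sformC Fz ?oppr0.
have c20 : c2 = 0.
  have := pair y; rewrite c00 c10 c50 az0 ?bz0 ?inE ?eqxx ?orbT //.
  rewrite -/(om x y) -/(om y y) om_alt.
  by rewrite !mul0r !mulr0 !addr0 !add0r => /eq0_om.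
have c30 : c3 = 0.
  have := pair x; rewrite c00 c10 c20 c50 az0 ?bz0 ?inE ?eqxx ?orbT //.
  rewrite -/(om y x). rewrite (om_skew y x) mulrN.
  rewrite !mul0r !mulr0 !addr0 !add0r => /eqP.
  by rewrite oppr_eq0 => /eqP/eq0_om.
(* By skewness, [a *m z] pairs with [v2] as [z] does with [- v3], while [b *m v2 = 0] removes the
   term in [c6]. *)
have c40 : c4 = 0.
  have := pair v2; rewrite c00 c10 c20 c30 c50 (skew_a z v2) (skew_b z v2) bv2 sform0r.
  rewrite !mul0r oppr0 mulr0 !addr0 !add0r (sformC B z) mulrN => /eqP.
  by rewrite oppr_eq0 mulf_eq0 (negbTE v3z) orbF => /eqP.
have c60 : c6 = 0.
  have := pair v1; rewrite c00 c10 c20 c30 c40 c50 (skew_b z v1).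
  rewrite !mul0r !add0r -sformNr -anti_v (sformC B z) => /eqP.
  by rewrite mulf_eq0 (negbTE v3z) orbF => /eqP.
by split.
Qed.

Lemma seven_le_index_of_vectors : (7 <= q)%N.
Proof.
apply: (isotropic_family_size Bpq _ free_family) => i j.
by apply: isotropic_family; rewrite mem_nth.
Qed.

End IsotropicSeven.

Lemma seven_le_index (R : realType) (n : nat) (B : {symmetric 'cV[R]_n})
    (p q : nat) (a b : 'M[R]_n) (v1 v2 : 'cV[R]_n) :
  has_signature B p q ->
  (forall u w, B (a *m u) w = - B u (a *m w)) ->
  (forall u w, B (b *m u) w = - B u (b *m w)) ->
  (forall u : 'cV[R]_n, a *m (a *m u) = 0) ->
  (forall u : 'cV[R]_n, b *m (b *m u) = 0) ->
  (forall u : 'cV[R]_n, b *m (a *m u) = - (a *m (b *m u))) ->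
  b *m v2 = 0 -> a *m v2 = - (b *m v1) -> a *m b != 0 ->
  (forall u : 'cV[R]_n, a *m v2 <> a *m (b *m u)) ->
  (7 <= q)%N.
Proof.
move=> Bpq skew_a skew_b aa bb anti_ab bv2 anti_v ab_neq0 v3_nim.
have [x [y xy]] := exists_om_neq0 Bpq ab_neq0.
have [z Fz v3z] := exists_orthogonal_vector Bpq skew_a skew_b aa bb anti_ab anti_v v3_nim xy.
exact: (seven_le_index_of_vectors Bpq skew_a skew_b aa bb anti_ab bv2 anti_v xy Fz v3z).
Qed.

Local Open Scope classical_set_scope.

(** * Algebraic consequences of a transitive centralizer *)

Section TransitiveCentralizer.
Variables (R : realType) (n : nat) (B : {symmetric 'cV[R]_n}) (p q : nat).
Variable (Gamma : set (affine R n)).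
Hypotheses (Bpq : has_signature B p q) (GammaB : Gamma `<=` Iso B).
Hypothesis tr : acts_transitively (centralizer (Iso B) Gamma).

Let A (g : affine R n) : 'M[R]_n := linpart g - 1%:M.

Lemma linpart_act g (u : 'cV[R]_n) : linpart g *m u = A g *m u + u.
Proof. by rewrite mulmxBl mul1mx subrK. Qed.

(** An isometry of the centralizer that sends [0] to [c] has translation part [c]; the last two
    properties compare the linear and translation parts of [z * g] and [g * z]. *)
Lemma exists_centralizing_linpart c : exists C : 'M[R]_n,
  [/\ C \in unitmx, (forall u w, B (C *m u) (C *m w) = B u w),
      (forall g, Gamma g -> C *m A g = A g *m C) &
      (forall g, Gamma g -> C *m transpart g = transpart g + A g *m c)].
Proof.
have [z [zB zG]] := tr 0 c; rewrite /affine_act mulmx0 add0r => zc.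
exists (linpart z); split=> [|//|g /zG|g /zG]; first exact: linpart_unit.
  move/(congr1 (@linpart R n)); rewrite /linpart/= -!/(linpart _) => zg.
  by rewrite /A mulmxBr mulmxBl zg mulmx1 mul1mx.
move/(congr1 (@transpart R n)); rewrite /transpart/= -!/(transpart _) zc => zg.
apply: (addIr c); rewrite zg addrC -addrA; congr (_ + _).
by rewrite /A mulmxBl mul1mx subrK.
Qed.

(** Expanding the invariance of the product of two translation parts under [C] gives a linear plus a
    quadratic expression in [c]; replacing [c] by [- c] makes each vanish. *)
Let Bvv_polar g h c : Gamma g -> Gamma h ->
  B (A g *m c) (A h *m c) = 0 /\
  B (transpart g) (A h *m c) = - B (A g *m c) (transpart h).
Proof.
move=> Gg Gh.
have key d : B (transpart g) (A h *m d) + B (A g *m d) (transpart h) +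
             B (A g *m d) (A h *m d) = 0.
  have [C [_ CB _ Cv]] := exists_centralizing_linpart d.
  have := CB (transpart g) (transpart h).
  by rewrite !Cv // sformDl !sformDr; lra.
have := key (- c); rewrite !mulmxN !sformNl !sformNr opprK.
by have := key c; lra.
Qed.

Let BAA g h c d : Gamma g -> Gamma h ->
  B (A g *m c) (A h *m d) = - B (A g *m d) (A h *m c).
Proof.
move=> Gg Gh; have [+ _] := Bvv_polar (c + d) Gg Gh.
have [cc _] := Bvv_polar c Gg Gh; have [dd _] := Bvv_polar d Gg Gh.
by rewrite !mulmxDr sformDl !sformDr cc dd; lra.
Qed.

(** The isometry condition on [I + A] differs from skewness by the product of [A c] and [A d], which
    is symmetric in [c, d] but also antisymmetric by [BAA], hence zero. *)
Lemma linpart_skew g c d : Gamma g -> B (A g *m c) d = - B c (A g *m d).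
Proof.
move=> Gg; have := GammaB Gg c d.
rewrite !linpart_act sformDl !sformDr.
have := BAA c d Gg Gg; rewrite (sformC B (A g *m d)).
lra.
Qed.

Lemma linpart_anticomm g h (c : 'cV[R]_n) : Gamma g -> Gamma h ->
  A g *m (A h *m c) = - (A h *m (A g *m c)).
Proof.
move=> Gg Gh; apply: (sform_inj Bpq) => d.
rewrite sformNl (linpart_skew (A h *m c) d Gg) (BAA c d Gh Gg).
by rewrite (linpart_skew (A g *m c) d Gh) sformC.
Qed.

Lemma linpart_sqr0 g (c : 'cV[R]_n) : Gamma g -> A g *m (A g *m c) = 0.
Proof.
move=> Gg; apply: (sform_nondegenerate Bpq) => d.
by have := linpart_anticomm c Gg Gg => /(congr1 (B^~ d)); rewrite sformNl; lra.
Qed.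

(** This is the linear half of [Bvv_polar] with [A g] and [A h] moved across the form. *)
Lemma transpart_anticomm g h : Gamma g -> Gamma h ->
  A g *m transpart h = - (A h *m transpart g).
Proof.
move=> Gg Gh; apply: (sform_inj Bpq) => d; have [_ vAd] := Bvv_polar d Gg Gh.
by rewrite sformNl !linpart_skew // opprK vAd sformC.
Qed.

Lemma non_abelian_index : ~ abelian_mx (Hol Gamma) -> (7 <= q)%N.
Proof.
(* If all products of the [A]'s vanished, linear parts would multiply by adding their [A]'s and so
   commute. *)
move=> nab; have [g [h [Gg Gh gh]]] : exists g h,
    [/\ Gamma g, Gamma h & A g *m A h != 0].
  apply: contrapT => none; apply: nab => _ _ [g Gg <-] [h Gh <-].
  have AA0 k l : Gamma k -> Gamma l -> A k *m A l = 0.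
    by move=> Gk Gl; apply: contrapT => /eqP kl; apply: none; exists k, l.
  have mulE k l : Gamma k -> Gamma l ->
      linpart k *m linpart l = linpart k + linpart l - 1%:M.
    move=> Gk Gl; apply/eqP; rewrite -subr_eq0 -(AA0 k l) //; apply/eqP.
    rewrite /A mulmxBl !mulmxBr !mul1mx mulmx1 !opprB opprD.
    by rewrite !addrA [X in X - _]addrAC.
  by rewrite /comm_mx !mulE // [linpart g + _]addrC.
have hh := transpart_anticomm Gh Gh.
have A0 (k : affine R n) : A k *m transpart k = - (A k *m transpart k) ->
    A k *m transpart k = 0.
  move=> kk; apply: (sform_nondegenerate Bpq) => d.
  by move/(congr1 (B^~ d)): kk; rewrite sformNl; lra.
apply: (@seven_le_index _ _ _ _ _ (A g) (A h) (transpart g) (transpart h) Bpq) => //.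
- by move=> u w; exact: linpart_skew.
- by move=> u w; exact: linpart_skew.
- by move=> u; exact: linpart_sqr0.
- by move=> u; exact: linpart_sqr0.
- by move=> u; exact: linpart_anticomm.
- exact: A0.
- exact: transpart_anticomm.
have Cv3 c : exists2 C : 'M[R]_n, C \in unitmx &
    C *m (A g *m transpart h) = A g *m transpart h + A g *m (A h *m c).
  have [C [uC _ CA Cv]] := exists_centralizing_linpart c; exists C => //.
  by rewrite mulmxA CA // -mulmxA Cv // mulmxDr.
(* Taking [c = - u] makes [C] annihilate [v3], so [v3 = 0]; then [Cv3] forces [A g *m A h] to kill
   every [c]. *)
move=> u v3u; have v30 : A g *m transpart h = 0.
  have [C uC] := Cv3 (- u); rewrite !mulmxN -v3u subrr => C0.
  by rewrite -[LHS](mulKmx uC) C0 mulmx0.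
case/eqP: gh; apply/matrixP => i j; have [C _] := Cv3 (delta_mx j 0).
rewrite v30 mulmx0 add0r mulmxA -colE => /colP/(_ i); by rewrite !mxE => <-.
Qed.
End TransitiveCentralizer.

(** * Invertibility criteria and matrices of linear maps *)

Lemma mulmx_injective_unit (K : fieldType) n (M : 'M[K]_n) :
  (forall u : 'cV[K]_n, M *m u = 0 -> u = 0) -> M \in unitmx.
Proof.
move=> M0; rewrite -unitmx_tr -row_free_unit -kermx_eq0.
apply/rowV0P => u /sub_kermxP uM; apply: trmx_inj; rewrite trmx0.
by apply: M0; apply: trmx_inj; rewrite trmx_mul trmxK uM trmx0.
Qed.

Lemma isometry_unit (R : realType) n (B : {symmetric 'cV[R]_n}) p q (M : 'M[R]_n) :
  has_signature B p q -> isometry B B (mulmx M) -> M \in unitmx.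
Proof.
move=> Bpq MB; apply: mulmx_injective_unit => u Mu.
by apply: (sform_nondegenerate Bpq) => w; rewrite -MB Mu sform0l.
Qed.

Lemma linear_map_matrix (K : fieldType) n (f : 'cV[K]_n -> 'cV[K]_n) :
  linear f -> exists M : 'M[K]_n, forall x, M *m x = f x.
Proof.
move=> flin; have f0 : f 0 = 0.
  by have /esym/(canRL (addrK _)) := flin 1 0 0; rewrite scaler0 addr0 scale1r subrr.
have fD : {morph f : u v / u + v}.
  by move=> u v; have := flin 1 u v; rewrite !scale1r.
exists (\matrix_(i, j) f (delta_mx j 0) i 0) => x.
have {2}-> : x = \sum_j x j 0 *: delta_mx j 0.
  by rewrite {1}(matrix_sum_delta x); apply: eq_bigr => j _; rewrite big_ord1.
rewrite (big_morph f fD f0); apply/colP => i; rewrite mxE summxE.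
apply: eq_bigr => j _; have := flin (x j 0) (delta_mx j 0) 0.
by rewrite !addr0 f0 addr0 => ->; rewrite !mxE mulrC.
Qed.

(** * The example in dimension 14, in explicit coordinates *)

Section Example.
Variable R : realType.

Let V := 'cV[R]_14.

(** Indices are natural numbers so that literals can be used; [inord] is faithful only for
    [k < 14]. *)
Definition coord (x : V) (k : nat) : R := x (inord k) 0.

Definition vec (s : seq R) : V := \col_i s`_i.

Lemma coord_vec s k : (k < 14)%N -> coord (vec s) k = s`_k.
Proof. by move=> lt_k; rewrite /coord mxE inordK. Qed.

Lemma coord0 k : coord 0 k = 0.
Proof. by rewrite /coord mxE. Qed.

Lemma coord_lin a (x y : V) k : coord (a *: x + y) k = a * coord x k + coord y k.
Proof. by rewrite /coord !mxE. Qed.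

Lemma coordK (x : V) : vec (mkseq (coord x) 14) = x.
Proof. by apply/colP => i; rewrite mxE nth_mkseq // /coord inord_val. Qed.

Lemma vec_lin a (s t : seq R) : size s = size t ->
  a *: vec s + vec t = vec [seq a * u.1 + u.2 | u <- zip s t].
Proof.
move=> st; apply/colP => i; rewrite !mxE.
have [lt|ge] := ltnP i (size s).
  by rewrite (nth_map (0, 0)) ?size_zip -?st ?minnn // nth_zip.
by rewrite !nth_default ?mulr0 ?addr0 ?size_map ?size_zip -?st ?minnn.
Qed.

Definition hyperbolic (x y : V) : R :=
  \sum_(k < 7) (coord x k * coord y (k + 7) + coord x (k + 7) * coord y k).

(* The coordinates are relative to the basis
   [A1 x, A1 y, A1 A2 x, A1 A2 y, A1 z, A2 z, v3,
    A2 y, - A2 x, y, - x, - v2, v1, z],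
   where [A1 = ex_lin1], [A2 = ex_lin2], [v3 = A1 v2 = - A2 v1]; the last seven
   vectors are dual to the first seven for [hyperbolic]. *)
Definition ex_lin1 (x : V) : V :=
  vec [:: - coord x 10; coord x 9; - coord x 8; coord x 7; coord x 13; 0;
          - coord x 11; 0; 0; 0; 0; 0; 0; 0].

Definition ex_lin2 (x : V) : V :=
  vec [:: 0; 0; - coord x 0; - coord x 1; 0; coord x 13; - coord x 12;
          coord x 9; coord x 10; 0; 0; 0; 0; 0].

(* [rest_twist c \o free_twist c] is a linear part for which translation by [c]
   centralizes the two affine maps.  The factor [free_twist c] takes care of the
   component of [c] in the span of the vectors [_ x], [_ y] of the basis, and
   [rest_twist c] of the component in the orthogonal complement. *)
Definition free_twist (c x : V) : V :=
  vec [:: coord x 0 - coord c 10 * coord x 12;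
          coord x 1 + coord c 9 * coord x 12;
          coord x 2 - coord c 8 * coord x 12 + coord c 0 * coord x 11
            - coord c 10 * coord x 6;
          coord x 3 + coord c 7 * coord x 12 + coord c 1 * coord x 11
            + coord c 9 * coord x 6;
          coord x 4 + coord c 9 * coord x 0 + coord c 10 * coord x 1
            - coord c 0 * coord x 9 - coord c 1 * coord x 10;
          coord x 5 + coord c 10 * coord x 7 - coord c 9 * coord x 8
            + coord c 8 * coord x 9 - coord c 7 * coord x 10;
          coord x 6;
          coord x 7 - coord c 9 * coord x 11;
          coord x 8 - coord c 10 * coord x 11;
          coord x 9; coord x 10; coord x 11; coord x 12;
          coord x 13 + coord c 10 * coord x 9 - coord c 9 * coord x 10].

Definition rest_twist (c x : V) : V :=
  vec [:: coord x 0; coord x 1; coord x 2; coord x 3;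
          coord x 4 + coord c 13 * coord x 12 - coord c 12 * coord x 13;
          coord x 5 - coord c 13 * coord x 11 + coord c 11 * coord x 13;
          coord x 6 - coord c 11 * coord x 12 + coord c 12 * coord x 11;
          coord x 7; coord x 8; coord x 9; coord x 10; coord x 11; coord x 12;
          coord x 13].

Ltac lin_coord :=
  move=> a u v; rewrite vec_lin //; congr vec; rewrite /= !coord_lin;
  do 14![apply: (congr2 cons); first by ring]; exact: erefl.

Ltac coord_eq :=
  congr vec; rewrite ?coord_vec //=; do 14![apply: (congr2 cons); first by ring]; exact: erefl.

Ltac hyp_eq :=
  rewrite /hyperbolic !big_ord_recl !big_ord0 !coord_vec //=; ring.

Lemma ex_lin1_linear : linear ex_lin1. Proof. lin_coord. Qed.
Lemma ex_lin2_linear : linear ex_lin2. Proof. lin_coord. Qed.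
Lemma free_twist_lin c : linear (free_twist c). Proof. lin_coord. Qed.
Lemma rest_twist_lin c : linear (rest_twist c). Proof. lin_coord. Qed.

Lemma free_twist_ex_lin1 c x : free_twist c (ex_lin1 x) = ex_lin1 (free_twist c x).
Proof. coord_eq. Qed.

Lemma free_twist_ex_lin2 c x : free_twist c (ex_lin2 x) = ex_lin2 (free_twist c x).
Proof. coord_eq. Qed.

Lemma rest_twist_ex_lin1 c x : rest_twist c (ex_lin1 x) = ex_lin1 (rest_twist c x).
Proof. coord_eq. Qed.

Lemma rest_twist_ex_lin2 c x : rest_twist c (ex_lin2 x) = ex_lin2 (rest_twist c x).
Proof. coord_eq. Qed.

Lemma hyperbolic_free_twist c x y : hyperbolic (free_twist c x) (free_twist c y) = hyperbolic x y.
Proof. hyp_eq. Qed.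

Lemma hyperbolic_rest_twist c x y : hyperbolic (rest_twist c x) (rest_twist c y) = hyperbolic x y.
Proof. hyp_eq. Qed.

Lemma coordD (x y : V) k : coord (x + y) k = coord x k + coord y k.
Proof. by rewrite -[x]scale1r coord_lin mul1r scale1r. Qed.

Lemma add_id_lin (f : V -> V) : linear f -> linear (fun x => x + f x).
Proof. by move=> flin a u v; rewrite flin scalerDr addrACA. Qed.

Lemma hyperbolic_ex_lin1 x y : hyperbolic (x + ex_lin1 x) (y + ex_lin1 y) = hyperbolic x y.
Proof.
rewrite /hyperbolic !big_ord_recl !big_ord0 !coordD !coord_vec //=; ring.
Qed.

Lemma hyperbolic_ex_lin2 x y : hyperbolic (x + ex_lin2 x) (y + ex_lin2 y) = hyperbolic x y.
Proof.
rewrite /hyperbolic !big_ord_recl !big_ord0 !coordD !coord_vec //=; ring.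
Qed.

Definition ex_v1 : V := vec [:: 0; 0; 0; 0; 0; 0; 0; 0; 0; 0; 0; 0; 1; 0].
(** The basis vector of index 11 is [- v2], whence the sign. *)
Definition ex_v2 : V := vec [:: 0; 0; 0; 0; 0; 0; 0; 0; 0; 0; 0; -1; 0; 0].

Lemma addv (s t : seq R) : size s = size t ->
  vec s + vec t = vec [seq u.1 + u.2 | u <- zip s t].
Proof.
move=> st; rewrite -[vec s]scale1r vec_lin //; congr vec.
by apply: eq_map => u; rewrite mul1r.
Qed.

(** This is the condition [C v = v + A c] under which the affine map with linear part [C] and
    translation [c] centralizes [(I + A, v)]. *)
Lemma twist_ex_v1 c : rest_twist c (free_twist c ex_v1) = ex_v1 + ex_lin1 c.
Proof.
have -> : free_twist c ex_v1 = vec [:: - coord c 10; coord c 9; - coord c 8; coord c 7;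
    0; 0; 0; 0; 0; 0; 0; 0; 1; 0] by coord_eq.
rewrite addv //; coord_eq.
Qed.

Lemma twist_ex_v2 c : rest_twist c (free_twist c ex_v2) = ex_v2 + ex_lin2 c.
Proof.
have -> : free_twist c ex_v2 = vec [:: 0; 0; - coord c 0; - coord c 1; 0; 0; 0;
    coord c 9; coord c 10; 0; 0; -1; 0; 0] by coord_eq.
rewrite addv //; coord_eq.
Qed.

Lemma ex_lin_noncomm : exists x, ex_lin1 (ex_lin2 x) <> ex_lin2 (ex_lin1 x).
Proof.
(* This is the basis vector [y]; the two composites send it to [A1 A2 y], of index 3, and to its
   opposite. *)
exists (vec [:: 0; 0; 0; 0; 0; 0; 0; 0; 0; 1; 0; 0; 0; 0]).
move/(congr1 (coord^~ 3)); rewrite !coord_vec //=; lra.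
Qed.

(** * Transport of the example to any form of signature (7, 7) *)

Variable B : {symmetric V}.
Hypothesis Bsig : has_signature B 7 7.

(** Since [ad + bc = (a/2 + b)(c/2 + d) - (a/2 - b)(c/2 - d)], these coordinates turn [hyperbolic]
    into seven squares minus seven squares. *)
Definition diagonalize (x : V) : V :=
  vec ([seq coord x k / 2 + coord x (k + 7) | k <- iota 0 7] ++
       [seq coord x k / 2 - coord x (k + 7) | k <- iota 0 7]).

Lemma diagonalize_lin : linear diagonalize. Proof. lin_coord. Qed.

Lemma diagonalize_inj0 x : diagonalize x = 0 -> x = 0.
Proof.
move=> hx; rewrite -[x]coordK -[RHS]coordK; congr vec; apply/eq_in_map => k.
rewrite mem_iota /= => k14; rewrite coord0.
have low j : (j < 7)%N -> coord x j = 0 /\ coord x (j + 7) = 0.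
  move=> j7; have := congr1 (coord^~ j) hx; have := congr1 (coord^~ (j + 7)%N) hx.
  rewrite !coord0; move: j j7 => [|[|[|[|[|[|[|//]]]]]]] _;
    rewrite !coord_vec //=; lra.
have [k7|k7] := ltnP k 7; first by have [] := low k k7.
have [|_] := low (k - 7)%N; first by rewrite ltn_subLR.
by rewrite subnK.
Qed.

Lemma exists_hyperbolic_basis : exists2 Q : 'M[R]_14, Q \in unitmx &
  forall x y, B (Q *m x) (Q *m y) = hyperbolic x y.
Proof.
have [_ [P uP BP]] := Bsig; have [H HE] := linear_map_matrix diagonalize_lin.
have uH : H \in unitmx.
  by apply: mulmx_injective_unit => x; rewrite HE; exact: diagonalize_inj0.
exists (P *m H); first by rewrite unitmx_mul uP.
move=> x y; rewrite -!mulmxA !HE (sform_diag _ _ BP).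
rewrite /hyperbolic !big_ord_recl !big_ord0 !mxE /=; by field.
Qed.

Variable Q : 'M[R]_14.
Hypotheses (uQ : Q \in unitmx)
           (QB : forall x y, B (Q *m x) (Q *m y) = hyperbolic x y).

Lemma exists_isometry (f : V -> V) t : linear f ->
    (forall x y, hyperbolic (f x) (f y) = hyperbolic x y) ->
  exists g : affine R 14, [/\ Iso B g, transpart g = Q *m t &
    forall x, linpart g *m (Q *m x) = Q *m f x].
Proof.
move=> flin fB; have [F FE] := linear_map_matrix flin.
pose M := Q *m F *m invmx Q.
have ME x : M *m (Q *m x) = Q *m f x by rewrite /M -!mulmxA mulKmx // FE.
have MB : isometry B B (mulmx M).
  by move=> u w; rewrite -[u](mulKVmx uQ) -[w](mulKVmx uQ) !ME !QB fB.
by exists (exist _ (M, Q *m t) (isometry_unit Bsig MB)).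
Qed.

Lemma linear_morphD (f : V -> V) : linear f -> {morph f : u w / u + w}.
Proof. by move=> flin u w; have := flin 1 u w; rewrite !scale1r. Qed.

(** Conversely to [exists_centralizing_linpart], the two relations on [C] suffice for [(C, c)] to
    commute with [(I + f, v)]. *)
Lemma act_commute (f C : V -> V) (v c : V) : linear f -> linear C ->
  (forall x, C (f x) = f (C x)) -> C v = v + f c ->
  forall x, C (x + f x + v) + c = C x + c + f (C x + c) + v.
Proof.
move=> /linear_morphD fD /linear_morphD CD Cf Cv x; rewrite !CD Cf Cv fD.
by rewrite !addrA -![_ + v + _]addrAC [_ + f c + c]addrAC [_ + f (C x) + c]addrAC.
Qed.

(** The affine action is faithful: the image of [0] gives the translation part, and the images of
    the basis vectors then give the linear part. *)
Lemma affine_commute (g h : affine R 14) :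
  (forall x, affine_act g (affine_act h x) = affine_act h (affine_act g x)) ->
  commute g h.
Proof.
move=> gh.
have tr_eq : transpart (g * h)%g = transpart (h * g)%g.
  by have := gh 0; rewrite -!affine_actM /affine_act !mulmx0 !add0r.
apply/val_inj/injective_projections; last exact: tr_eq.
apply/matrixP => i j; have := gh (delta_mx j 0).
rewrite -!affine_actM /affine_act tr_eq => /addIr/colP/(_ i).
by rewrite -!colE !mxE.
Qed.

Lemma exists_noncommuting_pair : exists g h : affine R 14,
  [/\ Iso B g, Iso B h, ~ comm_mx (linpart g) (linpart h) &
      forall c, exists k, [/\ Iso B k, commute k g, commute k h &
                              transpart k = Q *m c]].
Proof.
have [g [Bg tg gE]] := exists_isometry ex_v1 (add_id_lin ex_lin1_linear) hyperbolic_ex_lin1.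
have [h [Bh th hE]] := exists_isometry ex_v2 (add_id_lin ex_lin2_linear) hyperbolic_ex_lin2.
exists g, h; split=> // [gh|c].
  have [x] := ex_lin_noncomm; apply.
  have := congr1 (mulmx^~ (Q *m x)) gh; rewrite -!mulmxA !(gE, hE) => /(can_inj (mulKmx uQ)).
  by rewrite /= (linear_morphD ex_lin1_linear) (linear_morphD ex_lin2_linear)
    addrACA => /addrI/addrI.
have flin : linear (rest_twist c \o free_twist c).
  by move=> a u w; rewrite /= free_twist_lin rest_twist_lin.
have [|k [Bk tk kE]] := exists_isometry c flin.
  by move=> x y; rewrite /= hyperbolic_rest_twist hyperbolic_free_twist.
have cA (f : V -> V) : (forall x, free_twist c (f x) = f (free_twist c x)) ->
    (forall x, rest_twist c (f x) = f (rest_twist c x)) ->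
    forall x, (rest_twist c \o free_twist c) (f x) = f ((rest_twist c \o free_twist c) x).
  by move=> ff fr x; rewrite /= ff fr.
exists k; split=> //; apply: affine_commute => x; rewrite -[x](mulKVmx uQ).
  rewrite /affine_act !(tg, tk) !(gE, kE) -!mulmxDr !(gE, kE) -!mulmxDr; congr (Q *m _).
  apply: (act_commute ex_lin1_linear flin); last exact: twist_ex_v1.
  by apply: cA; [exact: free_twist_ex_lin1|exact: rest_twist_ex_lin1].
rewrite /affine_act !(th, tk) !(hE, kE) -!mulmxDr !(hE, kE) -!mulmxDr; congr (Q *m _).
apply: (act_commute ex_lin2_linear flin); last exact: twist_ex_v2.
by apply: cA; [exact: free_twist_ex_lin2|exact: rest_twist_ex_lin2].
Qed.

End Example.

(** * Double centralizers and the two halves of the theorem *)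

Lemma centralizer_subgroup (R : realType) n (B : {symmetric 'cV[R]_n}) (S : set (affine R n)) :
  is_subgroup (centralizer (Iso B) S) (Iso B).
Proof.
have [Iso1 IsoV] := Iso_group_closed B.
split=> [z []//|]; split.
  apply/mem_set; split; first exact/set_mem.
  by move=> g _; exact/commute_sym/commute1.
move=> z w /set_mem[Bz zS] /set_mem[Bw wS]; apply/mem_set; split.
  by apply/set_mem/IsoV; apply/mem_set.
move=> g Sg; apply/commute_sym/commuteM; first exact/commute_sym/zS.
by apply/commuteV/commute_sym/wS.
Qed.

Lemma orbit_transitive (R : realType) n (B : {symmetric 'cV[R]_n}) (G : set (affine R n)) :
  is_subgroup G (Iso B) -> (forall c, exists2 g, G g & affine_act g 0 = c) ->
  acts_transitively G.
Proof.
move=> [_ [_ GV]] G0 x y.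
have [g Gg gx] := G0 x; have [h Gh hy] := G0 y.
exists (h / g)%g; first by apply/set_mem/GV; apply/mem_set.
by rewrite -gx -affine_actM -mulgA mulVg mulg1.
Qed.

Lemma exists_non_abelian (R : realType) (B : {symmetric 'cV[R]_14}) :
  has_signature B 7 7 ->
  exists Gamma : set (affine R 14),
    [/\ is_subgroup Gamma (Iso B), acts_transitively (centralizer (Iso B) Gamma)
      & ~ abelian_mx (Hol Gamma)].
Proof.
move=> Bsig; have [Q uQ QB] := exists_hyperbolic_basis Bsig.
(* The double centralizer [G] contains [g] and [h], and every isometry commuting with these two
   commutes with all of [G]; so passing to [G] keeps the centralizer transitive. *)
have [g [h [Bg Bh gh tr]]] := exists_noncommuting_pair Bsig uQ QB.
pose L := centralizer (Iso B) [set g; h]; pose G := centralizer (Iso B) L.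
have GE k : Iso B k -> [set g; h] k -> G k.
  by move=> Bk ghk; split=> // l [_ lgh]; exact/commute_sym/lgh.
exists G; split.
- exact: centralizer_subgroup.
- apply: (orbit_transitive (centralizer_subgroup _ _)) => c.
  have [k [Bk kg kh kc]] := tr (invmx Q *m c).
  exists k; last by rewrite /affine_act mulmx0 add0r kc mulKVmx.
  split=> // l [_ lL]; apply/commute_sym/lL; split=> // m [->|->] //.
- move=> ab; apply: gh; apply: ab.
    by exists g => //; apply: GE => //; left.
  by exists h => //; apply: GE => //; right.
Qed.

Theorem theorem3p10 (R : realType) :
  (forall (n s : nat) (B : {symmetric 'cV[R]_n}) (Gamma : set (affine R n)),
     (s <= n - s)%N ->
     has_signature B (n - s) s ->
     is_subgroup Gamma (Iso B) ->
     acts_transitively (centralizer (Iso B) Gamma) ->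
     ~ abelian_mx (Hol Gamma) ->
     (7 <= s)%N /\ (14 <= n)%N)
  /\
  (forall B : {symmetric 'cV[R]_14},
     has_signature B (14 - 7) 7 ->
     exists Gamma : set (affine R 14),
       [/\ is_subgroup Gamma (Iso B),
           acts_transitively (centralizer (Iso B) Gamma)
         & ~ abelian_mx (Hol Gamma)]).
Proof.
split=> [n s B Gamma sn Bsig [GammaB _] tr nab|]; last exact: exists_non_abelian.
have s7 := non_abelian_index Bsig GammaB tr nab; split=> //.
have [nE _] := Bsig; rewrite -nE.
exact: leq_add (leq_trans s7 sn) s7.
Qed.
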